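(* Let $T$ be a tree rooted at $o$, let $X$ be either $\mathcal{L}_{\mathbf{w}}$ or $\mathcal{L}_{\mathbf{w},0}$, and let $\psi:T\to\mathbb{C}$ be such that $M_\psi$ is a bounded multiplication operator on $X$. Then $M_\psi$ is bounded below on $X$ if and only if $\inf_{v\in T}|\psi(v)|>0$.
   Context: A tree $T$ is a locally finite, connected, simply-connected graph, identified with its set of vertices; $T$ is assumed to have no terminal vertices (vertices with exactly one neighbor), so it is infinite, and it is rooted at a vertex $o$. $|v|$ is the number of edges in the unique path from $o$ to $v$; $T^*=T\setminus\{o\}$; for $v\in T^*$, $v^-$ is the neighbor of $v$ closest to $o$. For $f:T\to\mathbb{C}$ and $v\in T^*$, $Df(v)=|f(v)-f(v^-)|$. The weighted Lipschitz space $\mathcal{L}_{\mathbf{w}}$ is the set of $f:T\to\mathbb{C}$ with $\sup_{v\in T^*}|v|Df(v)<\infty$, normed by $\|f\|_{\mathbf{w}}=|f(o)|+\sup_{v\in T^*}|v|Df(v)$ (a Banach space). The little weighted Lipschitz space $\mathcal{L}_{\mathbf{w},0}$ is the closed subspace of those $f\in\mathcal{L}_{\mathbf{w}}$ with $\lim_{|v|\to\infty}|v|Df(v)=0$. $M_\psi f=\psi f$ (pointwise product); ''$M_\psi$ is bounded on $X$'' means $M_\psi$ maps $X$ into $X$ and is a bounded linear operator there. A bounded operator $S$ on a Banach space $X$ is bounded below if there is a constant $c>0$ with $\|Sx\|\ge c\|x\|$ for all $x\in X$. *)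

(* Defs.v *)
From HB Require Import structures.
From mathcomp Require Import all_boot all_order all_algebra.
From mathcomp Require Import all_classical all_reals all_analysis.
From mathcomp Require Import complex.
Set Implicit Arguments.
Unset Strict Implicit.
Unset Printing Implicit Defensive.
Import Order.TTheory GRing.Theory Num.Theory.
Import numFieldNormedType.Exports.
Local Open Scope classical_set_scope.
Local Open Scope ring_scope.

(* [tree_infinite] only excludes the graphs with at most one vertex: in every
   other case it follows from the remaining fields. *)
Record tree := Tree {
  vertex :> choiceType;
  adj : rel vertex;
  adj_sym : symmetric adj;
  adj_irr : irreflexive adj;
  tree_locally_finite : forall v, finite_set [set w | adj v w];
  tree_connected : forall u v, exists2 p, path adj u p & last u p = v;
  tree_acyclic : forall c : seq vertex, (2 < size c)%N -> ~ ucycle adj c;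
  tree_no_terminal : forall v, ~ exists w, [set u | adj v u] = [set w];
  tree_infinite : infinite_set [set: vertex]
}.

(* The path is stored without its starting point [u], so that its size is its
   number of edges. *)
Definition simple_path (T : tree) (u v : T) : set (seq T) :=
  [set p | [/\ path (@adj T) u p, last u p = v & uniq (u :: p)]].

Definition depth (T : tree) (o v : T) : nat := size (xget [::] (simple_path o v)).

(* Every vertex has a neighbor closest to [o], so the default is never used; for
   [v = o] the value is an arbitrary neighbor, without meaning. *)
Definition parent (T : tree) (o v : T) : T :=
  xget o [set w | adj v w /\ forall u, adj v u -> (depth o w <= depth o u)%N].

Section Spaces.
Variables (R : realType) (T : tree) (o : T).
Implicit Types (f psi : T -> R[i]) (X : set (T -> R[i]))
  (S : (T -> R[i]) -> (T -> R[i])).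

Definition variation f (v : T) : R := Normc.normc (f v - f (parent o v)).

Definition weighted_variation f (v : T) : R := (depth o v)%:R * variation f v.

Definition weighted_variations f : set R :=
  weighted_variation f @` [set v | v != o].

Definition wLipschitz : set (T -> R[i]) :=
  [set f | has_ubound (weighted_variations f)].

Definition wLipschitz_norm f : R :=
  Normc.normc (f o) + sup (weighted_variations f).

Definition depth_infty : set_system T :=
  filter_from [set: nat] (fun n => [set v | (n <= depth o v)%N]).

Definition little_wLipschitz : set (T -> R[i]) :=
  [set f | wLipschitz f /\ weighted_variation f @ depth_infty --> (0 : R)].

Definition mult_op psi : (T -> R[i]) -> (T -> R[i]) := fun f => psi \* f.

Definition bounded_operator X S : Prop :=
  [/\ forall f, X f -> X (S f),
      forall (a : R[i]) f g, X f -> X g ->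
        S ((a \*o f) \+ g) = (a \*o S f) \+ S g
    & exists C : R, forall f, X f ->
        wLipschitz_norm (S f) <= C * wLipschitz_norm f].

Definition bounded_below X S : Prop :=
  exists2 c : R, 0 < c &
    forall f, X f -> c * wLipschitz_norm f <= wLipschitz_norm (S f).

End Spaces.

(* Main.v *)
(** The indicator of a vertex [v] lies in both spaces, and [M_psi] multiplies it
    by the scalar [psi v]; so every lower bound and every upper bound of [M_psi]
    also bounds [|psi v|]. Conversely, let [|psi| >= d > 0]. The identity
      [g v^- (psi v - psi v^-) = (psi g) v - (psi g) v^- - psi v (g v - g v^-)]
    bounds [|v| |g v^-| D psi v] by a multiple of the norm of [g], for [g] in
    [X]. Taking [g = psi f], this and the quotient rule for [f = g / psi] bound
    [|v| D f v] by a multiple of the norm of [psi f]. *)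
Require Import Defs.
From HB Require Import structures.
From mathcomp Require Import all_boot all_order all_algebra.
From mathcomp Require Import all_classical all_reals all_analysis.
From mathcomp Require Import complex.
From mathcomp Require Import ring.
Import Order.TTheory GRing.Theory Num.Theory.
Import numFieldNormedType.Exports.
Local Open Scope classical_set_scope.
Local Open Scope ring_scope.

Lemma normc_ge0 {R : realType} (z : R[i]) : 0 <= Normc.normc z.
Proof. by case: z => a b; rewrite /Normc.normc sqrtr_ge0. Qed.

Lemma depth_gt0 {T : tree} (o v : T) : v != o -> (0 < depth o v)%N.
Proof.
move=> vo; rewrite lt0n; apply/negP => /eqP /size0nil H.
have [p pp lp] := tree_connected o v.
(* The default [[::]] also has size 0, so a simple path must be shown to exist before the chosen one
   can be used. *)
have : simple_path o v (xget [::] (simple_path o v)).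
  apply: xgetPex; case/shortenP: pp lp => q pq uq _ lq.
  by exists q.
rewrite H => -[_ /= ov _].
by rewrite -ov eqxx in vo.
Qed.

(** The default of [xget] is ruled out: connectedness gives [v] a neighbor because [v != o], and
    some neighbor has least depth. *)
Lemma parent_adj {T : tree} (o v : T) : v != o -> adj v (parent o v).
Proof.
move=> vo.
have [u vu] : exists u, adj v u.
  have [[|u p] /= pp lp] := tree_connected v o.
    by rewrite lp eqxx in vo.
  by exists u; case/andP: pp.
have mP : exists n, `[< exists2 w, adj v w & depth o w = n >].
  by exists (depth o u); apply/asboolP; exists u.
case: (ex_minnP mP) => n /asboolP[w vw wn] nmin.
have : [set w | adj v w /\ forall u, adj v u -> (depth o w <= depth o u)%N]
    (parent o v).
  apply: xgetPex; exists w; split=> // u' vu'; rewrite wn.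
  by apply: nmin; apply/asboolP; exists u'.
by case.
Qed.

Section WeightedLipschitz.
Context {R : realType} {T : tree}.
Variable o : T.
Implicit Types (f g psi : T -> R[i]) (X : set (T -> R[i])).

Let indic (v : T) : T -> R[i] := fun w => (w == v)%:R.

Lemma weighted_variation_ge0 f v : 0 <= weighted_variation o f v.
Proof. by rewrite mulr_ge0 ?ler0n ?normc_ge0. Qed.

Lemma weighted_variation_le_sup f v : wLipschitz o f -> v != o ->
  weighted_variation o f v <= sup (weighted_variations o f).
Proof. by move=> fL vo; apply: ub_le_sup => //; exists v. Qed.

(** Makes the set of weighted variations nonempty, so that its [sup] is nonnegative when finite and
    lies below every upper bound. *)
Lemma exists_neq_root : exists v : T, v != o.
Proof.
apply: contrapT => H; apply: (@tree_infinite T).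
apply: (@sub_finite_set _ _ [set o]); last exact: finite_set1.
by move=> v _ /=; apply/eqP; apply: contrapT => /negP vo; apply: H; exists v.
Qed.

Lemma sup_weighted_variations_ge0 f : wLipschitz o f ->
  0 <= sup (weighted_variations o f).
Proof.
move=> fL; have [v vo] := exists_neq_root.
exact: le_trans (weighted_variation_ge0 f v) (weighted_variation_le_sup f v fL vo).
Qed.

Lemma normc_root_le_norm f : wLipschitz o f -> Normc.normc (f o) <= wLipschitz_norm o f.
Proof. by move=> fL; rewrite lerDl sup_weighted_variations_ge0. Qed.

Lemma weighted_variation_le_norm f v : wLipschitz o f -> v != o ->
  weighted_variation o f v <= wLipschitz_norm o f.
Proof.
move=> fL vo; apply: le_trans (weighted_variation_le_sup f v fL vo) _.
by rewrite lerDr normc_ge0.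
Qed.

Lemma wLipschitz_norm_le f (A B : R) : Normc.normc (f o) <= A ->
  (forall v, v != o -> weighted_variation o f v <= B) ->
  wLipschitz_norm o f <= A + B.
Proof.
move=> fA fB; apply: lerD => //; apply: ge_sup.
  by have [v vo] := exists_neq_root; exists (weighted_variation o f v); exists v.
by move=> _ [v vo <-]; exact: fB.
Qed.

Lemma weighted_variationZ (a : R[i]) f v :
  weighted_variation o (a \*o f) v = Normc.normc a * weighted_variation o f v.
Proof.
rewrite /weighted_variation mulrCA; congr (_ * _); rewrite /Defs.variation -Normc.normcM.
by rewrite (mulrBr a (f v)).
Qed.

Lemma wLipschitz_normZ (a : R[i]) f : wLipschitz o f ->
  wLipschitz_norm o (a \*o f) = Normc.normc a * wLipschitz_norm o f.
Proof.
(* Only this inequality is proved directly; the converse is the same inequality for [a^-1] and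
   [a \*o f], with [a = 0] treated apart. *)
have le b g : wLipschitz o g ->
    wLipschitz_norm o (b \*o g) <= Normc.normc b * wLipschitz_norm o g.
  move=> gL; rewrite mulrDr; apply: wLipschitz_norm_le.
    by rewrite /= Normc.normcM.
  move=> v vo; rewrite weighted_variationZ ler_wpM2l ?normc_ge0 //.
  exact: weighted_variation_le_sup.
move=> fL; apply/eqP; rewrite eq_le le //=.
have afL : wLipschitz o (a \*o f).
  have [M fM] := fL; exists (Normc.normc a * M) => _ [v vo <-].
  by rewrite weighted_variationZ ler_wpM2l ?normc_ge0 //; apply: fM; exists v.
have [->|a0] := eqVneq a 0.
  rewrite Normc.normc0 mul0r addr_ge0 ?normc_ge0 //.
  have -> : 0 \*o f = 0 \*o (0 \*o f) by apply/funext => v /=; rewrite !mul0r.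
  apply: sup_weighted_variations_ge0.
  by exists 0 => _ [v vo <-]; rewrite weighted_variationZ Normc.normc0 mul0r.
have na0 : 0 < Normc.normc a.
  by rewrite lt_neqAle normc_ge0 andbT eq_sym; apply: contra_neq a0 => /Normc.eq0_normc.
have := le a^-1 _ afL; rewrite Normc.normcV.
have -> : a^-1 \*o (a \*o f) = f by apply/funext => v /=; rewrite mulKf.
by rewrite -ler_pdivlMl ?invr_gt0 // invrK.
Qed.

(** The parent of [w] is a neighbor of [w], hence not [v], so the indicator vanishes at both. *)
Lemma weighted_variation_indic_eq0 v w : w != o -> w != v -> ~~ adj v w ->
  weighted_variation o (indic v) w = 0.
Proof.
move=> wo wv vw; rewrite /weighted_variation /Defs.variation /indic (negbTE wv).
have -> : parent o w == v = false.
  by apply: contraNF vw => /eqP <-; rewrite adj_sym parent_adj.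
by rewrite subrr Normc.normc0 mulr0.
Qed.

(** Local finiteness enters here. It confines the nonzero weighted variations of the indicator of
    [v] to bounded depth. *)
Lemma depth_closed_neighborhood_bounded (v : T) :
  exists N, forall w, w = v \/ adj v w -> (depth o w <= N)%N.
Proof.
have /finite_seqP[s sE] := tree_locally_finite v.
exists (maxn (depth o v) (\max_(w <- s) depth o w)) => w; rewrite leq_max.
case=> [->|vw]; first by rewrite leqnn.
have : [set` s] w by rewrite -sE.
by move=> ws; apply/orP; right; exact: leq_bigmax_seq.
Qed.

Lemma variation_indic_le1 v w : Defs.variation o (indic v) w <= 1.
Proof.
rewrite /Defs.variation /indic; case: (w == v); case: (_ == v);
  by rewrite ?subrr ?subr0 ?sub0r ?normcN ?Normc.normc1 ?Normc.normc0 ?ler01.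
Qed.

Lemma indic_little_wLipschitz v : little_wLipschitz o (indic v).
Proof.
have [N depthN] := depth_closed_neighborhood_bounded v.
have far w : w != o -> (N < depth o w)%N -> weighted_variation o (indic v) w = 0.
  move=> wo Nw; apply: weighted_variation_indic_eq0 => //.
    by apply: contraTneq Nw => wv; rewrite -leqNgt depthN //; left.
  by apply: contraTN Nw => vw; rewrite -leqNgt depthN //; right.
split.
  exists N%:R => _ [w wo <-]; have [wN|Nw] := leqP (depth o w) N.
    apply: le_trans (_ : (depth o w)%:R <= _); last by rewrite ler_nat.
    by rewrite ler_piMr ?ler0n ?variation_indic_le1.
  by rewrite far ?ler0n.
apply: cvg_near_cst.
  apply: filter_fromT_filter; first by exists 0%N.
  move=> i j; exists (maxn i j) => w /=; rewrite geq_max.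
  by case/andP.
(* Going beyond [depth o o] as well keeps the root out, since [far] requires [w != o]. *)
exists (maxn N (depth o o)).+1 => // w /=; rewrite gtn_max => /andP[Nw ow].
by apply: far => //; apply: contraTneq ow => ->; rewrite ltnn.
Qed.

Lemma indic_wLipschitz v : wLipschitz o (indic v).
Proof. by have [] := indic_little_wLipschitz v. Qed.

(** For the root, the value there is 1. Otherwise the variation at [v] is 1, since the parent of
    [v], being adjacent to [v], differs from it. *)
Lemma indic_norm_gt0 v : 0 < wLipschitz_norm o (indic v).
Proof.
have iL := indic_wLipschitz v.
have [->|vo] := eqVneq v o.
  apply: lt_le_trans (normc_root_le_norm _ (indic_wLipschitz o)).
  by rewrite /indic eqxx Normc.normc1.
apply: lt_le_trans (weighted_variation_le_norm _ v iL vo).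
rewrite mulr_gt0 ?ltr0n ?depth_gt0 // /Defs.variation /indic eqxx.
have -> : parent o v == v = false.
  by apply/eqP => pv; have := parent_adj o v vo; rewrite pv adj_irr.
by rewrite subr0 Normc.normc1.
Qed.

Lemma mult_op_indic_norm psi v :
  wLipschitz_norm o (mult_op psi (indic v)) =
  Normc.normc (psi v) * wLipschitz_norm o (indic v).
Proof.
rewrite -wLipschitz_normZ; last exact: indic_wLipschitz.
congr wLipschitz_norm; apply/funext => w; rewrite /mult_op /indic /=.
by have [->|] := eqVneq w v; rewrite ?mulr0.
Qed.

Lemma mult_op_normc_bounds X psi : (forall v, X (indic v)) ->
  (forall C : R, (forall f, X f -> wLipschitz_norm o (mult_op psi f) <=
      C * wLipschitz_norm o f) -> forall v, Normc.normc (psi v) <= C) /\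
  (forall c : R, (forall f, X f -> c * wLipschitz_norm o f <=
      wLipschitz_norm o (mult_op psi f)) -> forall v, c <= Normc.normc (psi v)).
Proof.
move=> Xi; split=> C HC v; have := HC _ (Xi v);
  by rewrite mult_op_indic_norm ler_pM2r // indic_norm_gt0.
Qed.

(** A discrete product rule solved for the variation of [psi]; its factor is [g] at the parent, as
    in the quotient rule below. *)
Lemma variation_mulr_parent psi g v :
  Normc.normc (g (parent o v)) * Defs.variation o psi v <=
  Defs.variation o (mult_op psi g) v + Normc.normc (psi v) * Defs.variation o g v.
Proof.
rewrite /Defs.variation -!Normc.normcM /mult_op /=.
set a := psi v; set b := psi _; set c := g v; set d := g _.
have -> : d * (a - b) = (a * c - b * d) + - (a * (c - d)) by ring.
by apply: le_trans (le_normcD _ _) _; rewrite normcN.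
Qed.

(** Quotient rule for [f = g / psi] with [g = psi f]: dividing by a value of [psi] costs a factor
    [d^-1], once in the term with the variation of [g] and twice in the one with that of [psi]. *)
Lemma variation_div_le psi f v (d : R) : 0 < d ->
  (forall w, d <= Normc.normc (psi w)) ->
  Defs.variation o f v <= d^-1 * Defs.variation o (mult_op psi f) v +
    d^-1 ^+ 2 * (Normc.normc (mult_op psi f (parent o v)) * Defs.variation o psi v).
Proof.
move=> d0 dpsi.
have psi0 w : psi w != 0.
  by apply: contraTneq (dpsi w) => ->; rewrite Normc.normc0 -ltNge.
have Vle w : Normc.normc (psi w)^-1 <= d^-1.
  by rewrite Normc.normcV lef_pV2 ?posrE // (lt_le_trans d0).
rewrite /Defs.variation /mult_op /=.
have -> : f v - f (parent o v) =
    (psi v)^-1 * (psi v * f v - psi (parent o v) * f (parent o v)) +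
    - ((psi v)^-1 * (psi (parent o v))^-1 *
       (psi (parent o v) * f (parent o v) * (psi v - psi (parent o v)))).
  by field; rewrite !psi0.
apply: le_trans (le_normcD _ _) _; rewrite normcN !Normc.normcM.
apply: lerD; first by rewrite ler_wpM2r ?normc_ge0.
rewrite ler_wpM2r ?mulr_ge0 ?normc_ge0 // expr2.
by rewrite ler_pM ?normc_ge0.
Qed.

Lemma mult_op_bounded_below X psi (d : R) : X `<=` wLipschitz o ->
  (forall v, X (indic v)) -> bounded_operator o X (mult_op psi) ->
  0 < d -> (forall v, d <= Normc.normc (psi v)) ->
  bounded_below o X (mult_op psi).
Proof.
move=> XL Xi [XM _ [C HC]] d0 dpsi.
have [/(_ C HC) psiC _] := mult_op_normc_bounds X psi Xi.
have C0 : 0 <= C by exact: le_trans (normc_ge0 _) (psiC o).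
have di0 : 0 < d^-1 by rewrite invr_gt0.
(* The first [d^-1] serves the value at the root; the bracket is the quotient rule, with [C + C]
   coming from [cross]. *)
pose K := d^-1 + (d^-1 + d^-1 ^+ 2 * (C + C)).
have K0 : 0 < K by rewrite ltr_wpDr // addr_ge0 ?mulr_ge0 ?exprn_ge0 ?addr_ge0 // ltW.
exists K^-1; first by rewrite invr_gt0.
move=> f Xf; rewrite ler_pdivrMl //.
set g := mult_op psi f; set N := wLipschitz_norm o g.
have Xg : X g by exact: XM.
have gL : wLipschitz o g by exact: XL.
have N0 : 0 <= N by exact: le_trans (normc_ge0 _) (normc_root_le_norm _ gL).
rewrite /K mulrDl; apply: wLipschitz_norm_le => [|v vo].
  rewrite ler_pdivlMl //; apply: le_trans (normc_root_le_norm _ gL).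
  by rewrite /g /mult_op /= Normc.normcM ler_wpM2r ?normc_ge0.
have gN : weighted_variation o g v <= N by exact: weighted_variation_le_norm.
(* The product rule is applied to [g], which lies in [X] by invariance. One [C] bounds the norm of
   [psi g], the other bounds [psi v]. *)
have cross : (depth o v)%:R * (Normc.normc (g (parent o v)) * Defs.variation o psi v) <=
    (C + C) * N.
  apply: le_trans (ler_wpM2l (ler0n _ _) (variation_mulr_parent psi g v)) _.
  rewrite mulrDr mulrCA [leRHS]mulrDl; apply: lerD.
    apply: le_trans (weighted_variation_le_norm _ _ _ vo) (HC _ Xg).
    exact: XL (XM _ Xg).
  by rewrite ler_pM ?normc_ge0 ?weighted_variation_ge0.
apply: le_trans (ler_wpM2l (ler0n _ _) (variation_div_le psi f v d d0 dpsi)) _.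
rewrite mulrDr (mulrCA _ d^-1) (mulrCA _ (d^-1 ^+ 2)) mulrDl -(mulrA _ (C + C)).
by apply: lerD; apply: ler_wpM2l => //; rewrite ?exprn_ge0 // ltW.
Qed.

End WeightedLipschitz.

Theorem theorem6p5 (R : realType) (T : tree) (o : T) (X : set (T -> R[i]))
    (hX : X = wLipschitz o \/ X = little_wLipschitz o)
    (psi : T -> R[i]) (hpsi : bounded_operator o X (mult_op psi)) :
  bounded_below o X (mult_op psi) <->
  0 < inf (range (fun v : T => Normc.normc (psi v))).
Proof.
have XL : X `<=` wLipschitz o by case: hX => -> // f [].
have Xi v : X (fun w => (w == v)%:R).
  by case: hX => ->; [exact: indic_wLipschitz|exact: indic_little_wLipschitz].
split=> [[c c0 Hc]|inf0].
  apply: lt_le_trans c0 _; apply: lb_le_inf.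
    by exists (Normc.normc (psi o)); exists o.
  move=> _ [v _ <-].
  by have [_ /(_ c Hc)] := mult_op_normc_bounds o X psi Xi.
(* The infimum itself serves as the constant [d]. *)
apply: (mult_op_bounded_below o X psi _ XL Xi hpsi inf0) => v.
apply: ge_inf; last by exists v.
by exists 0 => _ [w _ <-]; exact: normc_ge0.
Qed.
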